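(* Let $M$ be a Hausdorff topological space and let $\mathcal{S}$ be a semilattice, with respect to set-theoretical union, of open-and-compact subsets of $M$, endowed with the topology $\mathfrak{T}$ with base $\mathfrak{B}$. Let $\mu$ be a regular Borel measure on $\mathcal{S}$. Let $$f(U):=\widetilde{\mu}(\psi_U)=\int_{\mathcal{S}}\psi_U(A)\,d\mu(A),$$ where $U$ is any nonempty open subset of $M$. Then for every set $\mathcal{V}(F;U_1,\dots,U_n)$ in the base $\mathfrak{B}$ one has $$\mu(\mathcal{V}(F;U_1,\dots,U_n))=(-1)^n(\Delta_{U_1}\circ\dots\circ\Delta_{U_n}f')(F),$$ where $f'(F):=f(M\setminus F)$, and $(\Delta_U\phi)(A)=\phi(A\cup U)-\phi(A)$ is a difference operator. Moreover, the (regular Borel) measure $\mu$ is uniquely determined by its values on $\mathfrak{B}$ given by this formula.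
   Context: A semilattice of subsets with respect to set-theoretical union is a family of sets $\mathcal{S}$ such that $A\cup B\in\mathcal{S}$ whenever $A,B\in\mathcal{S}$. For sets $E,G_1,\dots,G_n\subseteq M$ let $$\mathcal{V}(E;G_1,\dots,G_n):=\{A\in\mathcal{S}:A\cap E=\varnothing,\ A\cap G_i\neq\varnothing,\ i=1,\dots,n\}.$$ The open base $\mathfrak{B}$ of the topology $\mathfrak{T}$ on $\mathcal{S}$ consists of the sets $\mathcal{V}(F;U_1,\dots,U_n)$, where $F$ runs over closed subsets of $M$ and all $U_i$ run over open-and-closed subsets of $M$. For open $U\subseteq M$ the function $\psi_U$ on $\mathcal{S}$ is defined by $\psi_U(A)=1$ if $A\subseteq U$ and $\psi_U(A)=0$ otherwise. The Laplace transform $\widetilde{\mu}(\psi)=\int_{\mathcal{S}}\psi\,d\mu$ is considered for those Borel measurable $\psi$ for which the right-hand side exists. A Borel measure on $\mathcal{S}$ is a measure on the $\sigma$-algebra generated by $\mathfrak{T}$. Regular means outer regular (the measure of a Borel set is the infimum of the measures of the open sets containing it) and inner regular (the measure of a Borel set is the supremum of the measures of the compact sets contained in it). *)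

(* Defs.v *)
(* MathComp-Analysis *)
From HB Require Import structures.
From mathcomp Require Import all_boot all_order all_algebra.
From mathcomp Require Import all_classical all_reals all_analysis.

Set Implicit Arguments.
Unset Strict Implicit.
Unset Printing Implicit Defensive.

Import Order.TTheory GRing.Theory Num.Theory.
Import numFieldNormedType.Exports.

Local Open Scope classical_set_scope.
Local Open Scope ring_scope.

(* Nonemptiness is required because a [measurableType] is pointed. *)
Record semilattice (M : topologicalType) := Semilattice {
  family :> set (set M);
  family_neq0 : family !=set0;
  familyU : forall A B, family A -> family B -> family (A `|` B);
  family_open : forall A, family A -> open A;
  family_compact : forall A, family A -> compact A }.

(* An alias, so that the topology put on it below does not compete with the
   library's initial topology on [set_type]. *)
Definition points (M : topologicalType) (S : semilattice M) : Type :=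
  set_type (family S).

Definition to_set (M : topologicalType) (S : semilattice M) (A : points S) :
  set M := set_val A.
Coercion to_set : points >-> set.

Section points_topology.
Variables (M : topologicalType) (S : semilattice M).

HB.instance Definition _ := Choice.copy (points S) (set_type (family S)).

Let point_subproof : points S.
Proof.
have [A SA] := cid (family_neq0 S).
by exists A; rewrite inE.
Qed.

HB.instance Definition _ := isPointed.Build (points S) point_subproof.

Definition hit_miss (n : nat) (E : set M) (G : 'I_n -> set M) :
    set (points S) :=
  [set A | (A : set M) `&` E = set0 /\
           forall i, (A : set M) `&` G i !=set0].

(* The case n = 0 is included: otherwise the empty subset of M, if it belongs
   to S, would lie in no member of the base. *)
Definition hit_miss_base : set (set (points S)) :=
  [set V | exists (n : nat) (F : set M) (U : 'I_n -> set M),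
     [/\ closed F, forall i, clopen (U i) & V = hit_miss F U]].

Let hit_miss_cover : \bigcup_(V in hit_miss_base) V = setT.
Proof.
rewrite -subTset => A _; exists (hit_miss set0 (fun _ : 'I_0 => set0)).
  by exists 0%N, set0, (fun=> set0); split => //; [exact: closed0|case].
by split; [rewrite setI0|case].
Qed.

Let hit_miss_join (V W : set (points S)) (A : points S) :
  hit_miss_base V -> hit_miss_base W -> V A -> W A ->
  exists X, [/\ hit_miss_base X, X A & X `<=` V `&` W].
Proof.
move=> [n [F [U [cF cU ->]]]] [m [G [Y [cG cY ->]]]] [AF AU] [AG AY].
pose Z (i : 'I_(n + m)) :=
  match fintype.split i with inl j => U j | inr k => Y k end.
exists (hit_miss (F `|` G) Z); split.
- exists (n + m)%N, (F `|` G), Z; split => //; first exact: closedU.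
  by move=> i; rewrite /Z; case: (fintype.split i).
- split; first by rewrite setIUr AF AG setU0.
  by move=> i; rewrite /Z; case: (fintype.split i).
- move=> B []; rewrite setIUr setU_eq0 => -[BF BG] BZ.
  split; split => //.
    by move=> i; have := BZ (lshift m i); rewrite /Z (unsplitK (inl i)).
  by move=> i; have := BZ (rshift n i); rewrite /Z (unsplitK (inr i)).
Qed.

HB.instance Definition _ :=
  isBaseTopological.Build (points S) hit_miss_cover hit_miss_join.

End points_topology.

Definition borel (T : ptopologicalType) : Type := g_sigma_algebraType (@open T).
HB.instance Definition _ (T : ptopologicalType) :=
  Measurable.copy (borel T) (g_sigma_algebraType (@open T)).

Section regularity.
Variables (R : realType) (T : ptopologicalType).
Variable mu : {measure set (borel T) -> \bar R}.

Definition outer_regular := forall E : set (borel T), measurable E ->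
  mu E = ereal_inf [set mu O | O in [set O : set T | open O /\ E `<=` O]].

Definition inner_regular := forall E : set (borel T), measurable E ->
  mu E = ereal_sup [set mu K | K in [set K : set T | compact K /\ K `<=` E]].

Definition regular := outer_regular /\ inner_regular.

End regularity.

Section laplace.
Variables (R : realType) (M : topologicalType) (S : semilattice M).

Definition psi (U : set M) : points S -> R :=
  \1_[set A : points S | (A : set M) `<=` U].

Variable mu : {measure set (borel (points S)) -> \bar R}.

(* [laplace] has the junk value 0 when the integral is infinite; a transform is
   meant only for g satisfying [laplace_exists]. *)
Definition laplace_exists (g : points S -> R) : Prop :=
  mu.-integrable [set: borel (points S)] (EFin \o g).

Definition laplace (g : points S -> R) : R :=
  \int[mu]_(A in [set: borel (points S)]) g A.

End laplace.

Arguments psi {R M S} U _.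

Definition difference (R : realType) (T : Type) (U : set T)
  (phi : set T -> R) : set T -> R := fun A => phi (A `|` U) - phi A.

(* Main.v *)
Require Import Defs.
From HB Require Import structures.
From mathcomp Require Import all_boot all_order all_algebra.
From mathcomp Require Import all_classical all_reals all_analysis.

Import Order.TTheory GRing.Theory Num.Theory.
Import numFieldNormedType.Exports.
Local Open Scope classical_set_scope.
Local Open Scope ring_scope.

(** The formula is inclusion-exclusion, one clopen set at a time.  A set that
    misses F and meets U_1, ..., U_n is one that misses F and meets
    U_1, ..., U_(n-1), but does not miss all of F `|` U_n
    ([hit_miss_lift], which peels off the index 0).  Subtracting measures
    turns this set difference into minus one difference operator, and F `|` U_n
    is again closed, so that induction on n reduces everything to n = 0, where
    the measure of the sets contained in ~` F is the integral of their
    indicator function ([measure_hit_miss_difference], [laplace_psi]).  The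
    existence of the transform at F bounds all the measures that occur, so no
    subtraction is of the form oo - oo.

    Uniqueness needs only that the base is stable under intersection and that
    the space of points is Hausdorff ([regular_measure_unique]).  The first
    property propagates an agreement on the base to its finite unions, even
    where the measures are infinite ([measure_eq_finite_union]).  A compact set
    inside an open set O fits in such a finite union inside O, so inner
    regularity gives an agreement on open sets, and outer regularity carries it
    to all Borel sets.  The space of points is Hausdorff because the members of
    the semilattice, being compact and open in a Hausdorff space, are clopen
    ([points_hausdorff]). *)

(** * Regular measures that agree on a base *)

(** Induction on the number of sets, through
    m (V `|` W) + m (W `&` V) = m V + m W: the intersection of W with V is a
    union of as many sets of the pi-system as W, hence is covered by the
    induction hypothesis.  That hypothesis must therefore hold for every family
    F.  The identity determines m (V `|` W) when V has finite measure; when it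
    does not, the union has infinite measure for mu and for nu alike. *)
Lemma measure_eq_finite_union (d : measure_display) (T : measurableType d)
    (R : realType) (mu nu : {measure set T -> \bar R}) (G : set (set T)) :
  setI_closed G -> G `<=` measurable -> (forall V, G V -> mu V = nu V) ->
  forall (I : eqType) (s : seq I) (F : I -> set T),
    (forall i, i \in s -> G (F i)) ->
    mu (\big[setU/set0]_(i <- s) F i) = nu (\big[setU/set0]_(i <- s) F i).
Proof.
move=> GI Gm Geq I; elim=> [|i s IHs] F GF; first by rewrite big_nil !measure0.
have GFi : G (F i) by apply: GF; rewrite mem_head.
have GFs j : j \in s -> G (F j) by move=> js; apply: GF; rewrite inE js orbT.
rewrite big_cons; set V := F i; set W := \big[setU/set0]_(j <- s) F j.
have mV : measurable V by exact: Gm.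
have mW : measurable W.
  by rewrite /W big_seq; apply: bigsetU_measurable => j js; exact/Gm/GFs.
have mVW : measurable (V `|` W) by exact: measurableU.
have eqI : mu (W `&` V) = nu (W `&` V).
  rewrite /W big_distrl /= (IHs (fun j => F j `&` V))// => j js.
  exact: GI (GFs j js) GFi.
have VW (m : {measure set T -> \bar R}) : (m (V `|` W) = m V + m (W `\` V))%E.
  have -> : V `|` W = V `|` (W `\` V) by rewrite setDE setUIr setUCr setIT.
  by rewrite measureU//; [exact: measurableD|rewrite setDE setICA setICr setI0].
have [Vfin|Vinf] := ltP (mu V) +oo%E.
  have diffE (m : {measure set T -> \bar R}) :
      (m V < +oo -> m (W `\` V) = m W - m (W `&` V))%E.
    move=> mVfin; rewrite (measureDI m mW mV) addeK// ge0_fin_numE//.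
    apply: le_lt_trans mVfin; apply: le_measure; rewrite ?inE//.
    exact: measurableI.
  have eqW : mu W = nu W by exact: IHs.
  have nVfin : (nu V < +oo)%E by rewrite -Geq.
  by rewrite !VW !diffE// eqI eqW Geq.
have top (m : {measure set T -> \bar R}) :
    (+oo <= m V -> m (V `|` W) = +oo)%E.
  move=> mVinf; apply/eqP; rewrite eq_le leey /=.
  by apply: le_trans mVinf _; apply: le_measure; rewrite ?inE.
by rewrite !top// -Geq.
Qed.

Lemma compact_subset_finite_union (T : ptopologicalType) (G : set (set T))
    (K O : set T) :
  basis G -> compact K -> open O -> K `<=` O ->
  exists s : seq (set T), [/\ forall V, V \in s -> G V,
    K `<=` \big[setU/set0]_(V <- s) V & \big[setU/set0]_(V <- s) V `<=` O].
Proof.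
move=> [Go Gb]; rewrite compact_cover => cK oO KO.
have [] := cK _ [set V | G V /\ V `<=` O] id.
- by move=> V [/Go].
- move=> x /KO Ox.
  have [V [GV Vx] VO] := Gb x _ (open_nbhs_nbhs (conj oO Ox)).
  by exists V.
move=> D DG KD; exists (finmap.enum_fset D); split.
- by move=> V /DG; rewrite inE => -[].
- by rewrite -bigcup_seq.
- by rewrite -bigcup_seq => x [V /DG]; rewrite inE => -[_ VO] /VO.
Qed.

Section regular_uniqueness.
Variables (R : realType) (T : ptopologicalType).
Implicit Types mu nu : {measure set (borel T) -> \bar R}.

Lemma open_borel (O : set T) : open O -> measurable (O : set (borel T)).
Proof. by move=> oO; apply: sub_gen_smallest. Qed.

(** Monotonicity of a measure is restricted to measurable sets, while inner
    regularity quantifies over arbitrary compact sets: the Hausdorff property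
    is what makes these measurable. *)
Lemma compact_borel (K : set T) : hausdorff_space T -> compact K ->
  measurable (K : set (borel T)).
Proof.
move=> hT /(compact_closed hT) cK; rewrite -(setCK K).
by apply: measurableC; apply: open_borel; exact: closed_openC.
Qed.

(** Each compact K inside O has mu K <= mu W = nu W <= nu O, for W a finite union
    of basic open sets between K and O. *)
Lemma inner_regular_le_open mu nu (G : set (set T)) (O : set T) :
  hausdorff_space T -> basis G -> setI_closed G -> inner_regular mu ->
  (forall V, G V -> mu V = nu V) -> open O -> (mu O <= nu O)%E.
Proof.
move=> hT bG GI mu_inner Geq oO.
have Gm : G `<=` (measurable : set (set (borel T))).
  by move=> V /(proj1 bG); exact: open_borel.
rewrite (mu_inner _ (open_borel _ oO)).
apply: ge_ereal_sup => _ [K [cK KO] <-].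
have [s [sG Ks sO]] := compact_subset_finite_union _ _ _ _ bG cK oO KO.
have ms : measurable (\big[setU/set0]_(V <- s) V : set (borel T)).
  rewrite big_seq; apply: bigsetU_measurable => V Vs.
  exact: (Gm _ (sG _ Vs)).
apply: (@le_trans _ _ (mu (\big[setU/set0]_(V <- s) V))).
  by apply: le_measure; rewrite ?inE//; exact: compact_borel.
rewrite (measure_eq_finite_union _ (borel T) _ mu nu G GI Gm Geq)//.
by apply: le_measure; rewrite ?inE//; exact: open_borel.
Qed.

Lemma regular_measure_unique mu nu (G : set (set T)) :
  hausdorff_space T -> basis G -> setI_closed G ->
  regular mu -> regular nu -> (forall V, G V -> mu V = nu V) ->
  forall E : set (borel T), measurable E -> mu E = nu E.
Proof.
move=> hT bG GI [mu_outer mu_inner] [nu_outer nu_inner] Geq E mE.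
rewrite mu_outer// nu_outer//; congr ereal_inf; apply: eq_imagel => O [oO _].
apply/eqP; rewrite eq_le; apply/andP; split.
  exact: (inner_regular_le_open _ _ G).
by apply: (inner_regular_le_open _ _ G) => // V GV; rewrite Geq.
Qed.

End regular_uniqueness.

(** * The hit-or-miss topology *)

Section hit_miss_theory.
Variables (M : topologicalType) (S : semilattice M).

Lemma hit_miss_base_basis : basis (@hit_miss_base M S).
Proof.
split=> [V bV|A O].
  by exists [set V]; [move=> _ ->|rewrite bigcup_set1].
rewrite nbhsE => -[W [[D DG DW] WA] WO].
move: WA; rewrite -DW => -[V DV VA]; exists V; first by split => //; exact: DG.
by apply: subset_trans WO; rewrite -DW => B VB; exists V.
Qed.

Lemma hit_miss_base_setI : setI_closed (@hit_miss_base M S).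
Proof.
move=> _ _ [n [F [U [cF cU ->]]]] [m [H [Y [cH cY ->]]]].
pose Z (i : 'I_(n + m)) :=
  match fintype.split i with inl j => U j | inr k => Y k end.
exists (n + m)%N, (F `|` H), Z; split; first exact: closedU.
  by move=> i; rewrite /Z; case: (fintype.split i).
rewrite predeqE => B; split.
  move=> [[BF BU] [BH BY]]; split; first by rewrite setIUr BF BH setU0.
  by move=> i; rewrite /Z; case: (fintype.split i).
move=> []; rewrite setIUr setU_eq0 => -[BF BH] BZ.
split; split => // i.
  by have := BZ (lshift m i); rewrite /Z (unsplitK (inl i)).
by have := BZ (rshift n i); rewrite /Z (unsplitK (inr i)).
Qed.

Lemma hit_miss_open (n : nat) (F : set M) (U : 'I_n -> set M) :
  closed F -> (forall i, clopen (U i)) -> open (@hit_miss M S n F U).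
Proof.
by move=> cF cU; apply: (proj1 hit_miss_base_basis); exists n, F, U.
Qed.

(** If x lies in C but not in D, then D misses the clopen set C `\` D and C
    meets it, so the two corresponding basic sets separate C from D. *)
Lemma points_hausdorff : hausdorff_space M -> hausdorff_space (points S).
Proof.
move=> hM A B clAB; apply: val_inj; rewrite predeqE.
suff sub (C D : points S) : cluster (nbhs C) D -> (C : set M) `<=` D.
  move=> x; split; apply: sub => // X Y nX nY.
  by rewrite setIC; exact: clAB.
move=> {A B clAB} clCD x Cx; apply: contrapT => nDx.
have clop (A : points S) : clopen (A : set M).
  have SA : Defs.family S A by exact: set_valP.
  split; first exact: family_open SA.
  by apply: compact_closed => //; exact: family_compact SA.
have cCD : clopen ((C : set M) `\` D).
  by rewrite setDE; apply: clopenI => //; apply: (clopenC set0).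
have [|| ] := clCD (hit_miss set0 (fun _ : 'I_1 => (C : set M) `\` D))
                (hit_miss ((C : set M) `\` D) (fun _ : 'I_0 => set0)).
- apply: open_nbhs_nbhs; split.
    by apply: hit_miss_open => //; exact: closed0.
  by split; [rewrite setI0|move=> _; exists x].
- apply: open_nbhs_nbhs; split; first by apply: hit_miss_open; [case: cCD|case].
  by split; [rewrite setDE setICA setICr setI0|case].
by move=> A [[_ /(_ ord0)[y Ay]] [/seteqP[/(_ y) + _] _]]; apply.
Qed.

(** Meeting U ord0 is the negation of missing it, and missing both F and U ord0
    is missing their union: the constraint with index 0 is traded for a larger
    closed set to be missed. *)
Lemma hit_miss_lift (n : nat) (F : set M) (U : 'I_n.+1 -> set M) :
  @hit_miss M S n.+1 F U =
  hit_miss F (U \o lift ord0) `\` hit_miss (F `|` U ord0) (U \o lift ord0).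
Proof.
rewrite predeqE => A; split=> [[AF AU]|[[AF AU] nA]].
  split; first by split => // i; exact: AU.
  by move=> [+ _]; rewrite setIUr setU_eq0 => -[_]; exact/eqP/set0P.
split => // i; case: (unliftP ord0 i) => [j ->|->]; first exact: AU.
apply: contrapT => /set0P/negP/negPn/eqP AU0.
by apply: nA; split => //; rewrite setIUr AF AU0 setU0.
Qed.

Definition inside (U : set M) : set (points S) :=
  [set A | (A : set M) `<=` U].

Lemma hit_miss_ord0 (F : set M) (U : 'I_0 -> set M) :
  @hit_miss M S 0 F U = inside (~` F).
Proof.
rewrite predeqE => A; split => [[/disjoints_subset]//|AF].
by split; [exact/disjoints_subset|case].
Qed.

Lemma hit_miss_borel (n : nat) (F : set M) (U : 'I_n -> set M) :
  closed F -> (forall i, clopen (U i)) ->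
  measurable (hit_miss F U : set (borel (points S))).
Proof.
by move=> cF cU; exact: (open_borel _ _ (hit_miss_open _ _ _ cF cU)).
Qed.

Lemma inside_borel (F : set M) : closed F ->
  measurable (inside (~` F) : set (borel (points S))).
Proof.
move=> cF; rewrite -(hit_miss_ord0 _ (fun=> set0)).
by apply: hit_miss_borel => // -[].
Qed.

(** * Inclusion-exclusion *)

Variables (R : realType) (mu : {measure set (borel (points S)) -> \bar R}).

(** The hypothesis on [phi] concerns closed sets only, because the points of S
    contained in ~` H need not form a Borel set otherwise; this suffices, as
    the difference operators only add the closed sets U i to F. *)
Lemma measure_hit_miss_difference (phi : set M -> R) (n : nat) (F : set M)
    (U : 'I_n -> set M) :
  (forall H, closed H -> mu (inside (~` H)) < +oo ->
     mu (inside (~` H)) = (phi H)%:E)%E ->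
  closed F -> (forall i, clopen (U i)) ->
  (mu (inside (~` F)) < +oo)%E ->
  mu (hit_miss F U) =
    ((-1) ^+ n * (\big[comp/id]_(i < n) difference (U i)) phi F)%:E.
Proof.
move=> phiE; elim: n F U => [|n IHn] F U cF cU Ffin.
  by rewrite hit_miss_ord0 big_ord0 expr0 mul1r phiE.
have cFU : closed (F `|` U ord0) by apply: closedU => //; case: (cU ord0).
have cUl i : clopen ((U \o lift ord0) i) by exact: cU.
have FUfin : (mu (inside (~` (F `|` U ord0))) < +oo)%E.
  apply: le_lt_trans Ffin; apply: le_measure; rewrite ?inE.
  - exact: inside_borel.
  - exact: inside_borel.
  - by move=> A AFU x /AFU; rewrite setCU => -[].
pose V := U \o lift ord0.
have Vfin : (mu (hit_miss F V) < +oo)%E by rewrite IHn ?ltry.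
have VU : hit_miss (F `|` U ord0) V `<=` (hit_miss F V : set (points S)).
  by move=> A [+ AV]; rewrite setIUr setU_eq0 => -[AF _].
have -> : mu (hit_miss F U) =
    (mu (hit_miss F V) - mu (hit_miss (F `|` U ord0) V))%E.
  rewrite hit_miss_lift -[in RHS](setIidr VU).
  by apply: measureD => //; exact: hit_miss_borel.
rewrite !IHn// big_ord_recl /= /difference -EFinB exprS mulN1r.
by congr EFin; rewrite mulNr -mulrN opprB mulrBr.
Qed.

Lemma laplace_psi (F : set M) : closed F ->
  (mu (inside (~` F)) < +oo)%E ->
  mu (inside (~` F)) = (laplace mu (psi (~` F)))%:E.
Proof.
move=> cF Ffin.
have mF := inside_borel _ cF.
rewrite /laplace /Rintegral /psi integral_indic// setIT fineK//.
by rewrite ge0_fin_numE.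
Qed.

Lemma laplace_exists_measure_lty (F : set M) : closed F ->
  laplace_exists mu (psi (~` F)) ->
  (mu (inside (~` F)) < +oo)%E.
Proof.
move=> cF /integrableP[_].
have mF := inside_borel _ cF.
under eq_integral do rewrite /= ger0_norm//.
by rewrite /psi integral_indic// setIT.
Qed.

End hit_miss_theory.

Theorem theorem9 (R : realType) (M : topologicalType)
    (hM : hausdorff_space M) (S : semilattice M)
    (mu : {measure set (borel (points S)) -> \bar R})
    (mu_regular : regular mu) :
  let f : set M -> R := fun U => laplace mu (psi U) in
  let f' : set M -> R := fun F => f (~` F) in
  (forall (n : nat) (F : set M) (U : 'I_n -> set M),
     closed F -> (forall i, clopen (U i)) ->
     laplace_exists mu (psi (~` F)) ->
     mu (hit_miss F U) =
       ((-1) ^+ n * (\big[comp/id]_(i < n) difference (U i)) f' F)%:E)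
  /\
  (forall nu : {measure set (borel (points S)) -> \bar R},
     regular nu ->
     (forall V, hit_miss_base V -> nu V = mu V) ->
     forall E : set (borel (points S)), measurable E -> nu E = mu E).
Proof.
move=> f f'; split=> [n F U cF cU Fex|nu nu_regular numu].
  apply: measure_hit_miss_difference => //; first exact: laplace_psi.
  exact: laplace_exists_measure_lty.
apply: (regular_measure_unique _ _ _ _ (@hit_miss_base M S)) => //.
- exact: points_hausdorff.
- exact: hit_miss_base_basis.
- exact: hit_miss_base_setI.
Qed.
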